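(* Let $G,H$ be graphs. Identify $\mathcal F_{\mathscr P}(\mathrm{Hom}(G,H))$ with a subposet of $C(\mathrm{hom}_{\mathscr G}(G,H))$ by the injective poset map $\Psi$ sending an indexing function $\eta$ to the set $\Psi(\eta)$ of all morphisms associated to $\eta$. Then $$C(\mathrm{hom}_{\mathscr G}(G,H))\searrow^{d}\mathcal F_{\mathscr P}(\mathrm{Hom}(G,H)).$$
   Context: Graphs are finite, undirected, without parallel edges; loops are allowed. A morphism of graphs is a vertex map preserving adjacency. $\mathrm{hom}_{\mathscr G}(G,H)$ is the (reflexive) graph whose vertices are the morphisms $G\to H$, with $f\sim f'$ iff for all $x,y\in V(G)$, $x\sim y$ in $G$ implies $f(x)\sim f'(y)$ in $H$. $C(G)$ denotes the poset of nonempty complete subgraphs of a graph $G$ (nonempty vertex sets any two distinct elements of which are adjacent), ordered by inclusion. The cells of the polyhedral complex $\mathrm{Hom}(G,H)$ are indexed by the indexing functions, i.e. functions $\eta:V(G)\to 2^{V(H)}\setminus\{\emptyset\}$ such that $x\sim y$ in $G$ implies that every element of $\eta(x)$ is adjacent in $H$ to every element of $\eta(y)$. Its face poset $\mathcal F_{\mathscr P}(\mathrm{Hom}(G,H))$ is the set of all indexing functions with $\eta\le\eta'$ iff $\eta(x)\subset\eta'(x)$ for all $x\in V(G)$. A morphism associated to $\eta$ is a map $f:V(G)\to V(H)$ with $f(x)\in\eta(x)$ for all $x$ (any such map is a morphism $G\to H$); the set $\Psi(\eta)$ of all of them induces a complete subgraph of $\mathrm{hom}_{\mathscr G}(G,H)$.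 In a finite poset $P$, an element $p$ is dismantlable if $P_{>p}=\{y:y>p\}$ has a least element or $P_{<p}=\{y:y<p\}$ has a greatest element. $P\searrow^{d}Q$ means that one can go from $P$ to the subposet $Q$ by successively deleting elements, each dismantlable in the poset from which it is deleted. *)

(* Defs.v *)
From HB Require Import structures.
From mathcomp Require Import all_boot all_order.

Set Implicit Arguments.
Unset Strict Implicit.
Unset Printing Implicit Defensive.

Import Order.TTheory.

(* Adjacency is not required to be irreflexive: loops are allowed. *)
Record graph := Graph {
  vertex :> finType;
  adj : rel vertex;
  adj_sym : symmetric adj }.

Section Hom.

Variables G H : graph.

Definition is_morphism (f : {ffun G -> H}) : bool :=
  [forall x, forall y, adj x y ==> adj (f x) (f y)].

Record morphism := Morphism {
  mor_fun :> {ffun G -> H};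
  mor_funP : is_morphism mor_fun }.

HB.instance Definition _ := [isSub for mor_fun].
HB.instance Definition _ := [Finite of morphism by <:].

Definition hom_adj : rel morphism := fun f g =>
  [forall x, forall y, adj x y ==> adj (f x) (g y)].

Lemma hom_adj_sym : symmetric hom_adj.
Proof.
suff h f g : hom_adj f g -> hom_adj g f by move=> f g; apply/idP/idP; apply: h.
move=> /forallP fg; apply/forallP => x; apply/forallP => y; apply/implyP => xy.
by rewrite adj_sym; apply: (implyP (forallP (fg y) x)); rewrite adj_sym.
Qed.

Definition hom_graph : graph := Graph hom_adj_sym.

End Hom.

Section Cliques.

Variable G : graph.

Definition is_clique (A : {set G}) : bool :=
  (A != set0) && [forall x in A, forall y in A, (x != y) ==> adj x y].

(* The poset C(G) of nonempty complete subgraphs of G. *)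
Record clique := Clique {
  clique_set :> {set G};
  clique_setP : is_clique clique_set }.

HB.instance Definition _ := [isSub for clique_set].
HB.instance Definition _ := [Finite of clique by <:].

Definition clique_le (A B : clique) : bool := clique_set A \subset clique_set B.

Fact clique_le_refl : reflexive clique_le.
Proof. by move=> A; apply: subxx. Qed.

Fact clique_le_anti : antisymmetric clique_le.
Proof. by move=> A B AB; apply/val_inj/eqP; rewrite eqEsubset. Qed.

Fact clique_le_trans : transitive clique_le.
Proof. by move=> B A C; apply: subset_trans. Qed.

Fact clique_display : Order.disp_t. Proof. exact: Order.Disp tt tt. Qed.

HB.instance Definition _ := Order.Le_isPOrder.Build clique_display clique
  clique_le_refl clique_le_anti clique_le_trans.

End Cliques.

Section Indexing.

Variables G H : graph.

Definition is_indexing (eta : {ffun G -> {set H}}) : bool :=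
  [forall x, eta x != set0] &&
  [forall x, forall y, adj x y ==>
     [forall u in eta x, forall v in eta y, adj u v]].

(* The face poset of the polyhedral complex Hom(G, H). *)
Record indexing := Indexing {
  idx_fun :> {ffun G -> {set H}};
  idx_funP : is_indexing idx_fun }.

HB.instance Definition _ := [isSub for idx_fun].
HB.instance Definition _ := [Finite of indexing by <:].

Definition indexing_le (eta eta' : indexing) : bool :=
  [forall x, eta x \subset eta' x].

Fact indexing_le_refl : reflexive indexing_le.
Proof. by move=> eta; apply/forallP => x; apply: subxx. Qed.

Fact indexing_le_anti : antisymmetric indexing_le.
Proof.
move=> e e' /andP[/forallP h /forallP h']; apply/val_inj/ffunP => x.
by apply/eqP; rewrite eqEsubset h h'.
Qed.

Fact indexing_le_trans : transitive indexing_le.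
Proof.
move=> e' e e'' /forallP h /forallP h'; apply/forallP => x.
exact: subset_trans (h x) (h' x).
Qed.

Fact indexing_display : Order.disp_t. Proof. exact: Order.Disp tt tt. Qed.

HB.instance Definition _ := Order.Le_isPOrder.Build indexing_display indexing
  indexing_le_refl indexing_le_anti indexing_le_trans.

Lemma indexing_neq0 (eta : indexing) x : eta x != set0.
Proof. by have /andP[/forallP] := idx_funP eta. Qed.

Lemma indexing_adj (eta : indexing) x y u v :
  adj x y -> u \in eta x -> v \in eta y -> adj u v.
Proof.
have /andP[_ /forallP/(_ x)/forallP/(_ y)/implyP h] := idx_funP eta.
by move=> /h/forall_inP h' /h'/forall_inP; apply.
Qed.

Definition associated (eta : indexing) (f : {ffun G -> H}) : bool :=
  [forall x, f x \in eta x].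

Lemma associated_morphism eta f : associated eta f -> is_morphism f.
Proof.
move=> /forallP h; apply/forallP => x; apply/forallP => y; apply/implyP => xy.
exact: indexing_adj xy (h x) (h y).
Qed.

Definition Psi_set (eta : indexing) : {set hom_graph G H} :=
  [set f : morphism G H | associated eta f].

Lemma Psi_clique eta : is_clique (Psi_set eta).
Proof.
apply/andP; split; last first.
  apply/forall_inP => f; rewrite inE => /forallP fe.
  apply/forall_inP => g; rewrite inE => /forallP ge; apply/implyP => _.
  apply/forallP => x; apply/forallP => y; apply/implyP => xy.
  exact: indexing_adj xy (fe x) (ge y).
have h x : {u | u \in eta x}.
  by apply: sigW; apply/set0Pn; apply: indexing_neq0.
have fe : associated eta [ffun x => sval (h x)].
  by apply/forallP => x; rewrite ffunE; case: (h x).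
apply/set0Pn; exists (Morphism (associated_morphism fe)).
by rewrite inE.
Qed.

Definition Psi (eta : indexing) : clique (hom_graph G H) :=
  Clique (Psi_clique eta).

End Indexing.

(* Subposets of P are represented by sets of elements of P with the induced
   order. *)
Section Dismantling.

Context {d : Order.disp_t} {P : finPOrderType d}.
Implicit Types (X Y : {set P}) (p : P).

Definition has_least X : bool := [exists m in X, forall y in X, (m <= y)%O].

Definition has_greatest X : bool := [exists m in X, forall y in X, (y <= m)%O].

Definition dismantlable X p : bool :=
  has_least [set y in X | (p < y)%O] || has_greatest [set y in X | (y < p)%O].

Inductive dismantles : {set P} -> {set P} -> Prop :=
| dismantles_refl X : dismantles X X
| dismantles_step X Y p :
    p \in X -> dismantlable X p -> dismantles (X :\ p) Y -> dismantles X Y.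

End Dismantling.

(* Main.v *)
Require Import Defs.
From mathcomp Require Import all_boot all_order.

Import Order.TTheory.

(** The map [Psi] is a right adjoint.  A clique [K] of morphisms [G -> H] has a
    pointwise span, the indexing function [x |-> {f x | f in K}], and an indexing
    function [eta] contains this span if and only if every morphism of [K] is
    associated to [eta]:

      [span K <= eta] iff [K <= Psi eta]   ([span_Psi_adj]).

    Moreover [span (Psi eta) = eta] ([PsiK]), because every point of every
    [eta x] is the value at [x] of some morphism associated to [eta].  Together
    these two facts make [Psi] an order embedding.

    The dismantling is then a fact about adjunctions between finite posets
    ([dismantles_adjoint]): a finite poset [P] dismantles to the image of any
    right adjoint [r : Q -> P].  One deletes the elements outside the image from
    the top down.  When [p] is deleted, everything left above it lies in the image
    of [r], and the least element of the image above [p] is [r (l p)], where [l]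
    is the left adjoint. *)

Section Adjunction.

Context {d d' : Order.disp_t} {P : finPOrderType d} {Q : finPOrderType d'}.
Variables (l : P -> Q) (r : Q -> P).
Hypothesis lr_adj : forall p q, (l p <= q)%O = (p <= r q)%O.

Lemma adjoint_unit p : (p <= r (l p))%O.
Proof. by rewrite -lr_adj. Qed.

Lemma right_adjoint_homo : {homo r : q q' / (q <= q')%O}.
Proof. by move=> q q' qq'; rewrite -lr_adj; apply: le_trans qq'; rewrite lr_adj. Qed.

(** Every element of [X] above [p] is some [r q], and [p <= r q] forces
    [r (l p) <= r q]; so [r (l p)] is the least element of [X] above [p].  It
    differs from [p] since it is in the image. *)
Lemma dismantlable_adjoint (X : {set P}) p :
    r @: setT \subset X -> p \notin r @: setT ->
    (forall y, y \in X -> (p < y)%O -> y \in r @: setT) ->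
  dismantlable X p.
Proof.
move=> /subsetP imX p_im above; apply/orP; left.
have rlp_im : r (l p) \in r @: setT by apply: imset_f.
apply/exists_inP; exists (r (l p)).
  rewrite inE imX //= lt_neqAle adjoint_unit andbT.
  by apply: contraNneq p_im => ->.
apply/forall_inP => y; rewrite inE => /andP[yX py].
have /imsetP[q _ def_y] := above y yX py.
by rewrite def_y right_adjoint_homo // lr_adj -def_y ltW.
Qed.

(** Stated for every [X] containing the image, so that the induction on the
    number of elements left to delete goes through: a maximal element of [X]
    outside the image can be deleted by [dismantlable_adjoint]. *)
Lemma dismantles_adjoint_sub (X : {set P}) :
  r @: setT \subset X -> dismantles X (r @: setT).
Proof.
have [n] := ubnP #|X :\: r @: setT|; elim: n X => // n IHn X ltXn imX.
have [XsubIm|/subsetPn[p0 p0X p0_im]] := boolP (X \subset r @: setT).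
  have -> : X = r @: setT by apply/eqP; rewrite eqEsubset XsubIm.
  exact: dismantles_refl.
(* An element whose up-set in [P] has the fewest elements is maximal. *)
have D_p0 : p0 \in X :\: r @: setT by rewrite inE p0_im.
case: (arg_minnP (fun p => #|[set y | (p <= y)%O]|) D_p0) => p.
move=> /setDP[pX p_im] p_min.
have above y : y \in X -> (p < y)%O -> y \in r @: setT.
  move=> yX py; apply: contraT => y_im.
  have /p_min : y \in X :\: r @: setT by rewrite inE y_im.
  rewrite leqNgt => /negP[]; apply: proper_card; apply/properP; split.
    by apply/subsetP => z; rewrite !inE; apply: le_trans (ltW py).
  by exists p; rewrite inE // (lt_geF py).
apply: (dismantles_step pX) => //; first exact: dismantlable_adjoint.
apply: IHn; last by rewrite subsetD1 imX.
rewrite -ltnS; apply: leq_trans ltXn; rewrite ltnS.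
apply: proper_card; apply/properP; split; first by rewrite setSD // subsetDl.
by exists p; rewrite !inE ?eqxx ?p_im.
Qed.

Lemma dismantles_adjoint : dismantles [set: P] (r @: setT).
Proof. by apply: dismantles_adjoint_sub; apply: subsetT. Qed.

End Adjunction.

Section Span.

Variables G H : graph.
Implicit Types (K : clique (hom_graph G H)) (eta : indexing G H).

(** Loops matter here: a clique only relates distinct morphisms, but every
    vertex of the hom graph is adjacent to itself, by preservation of
    adjacency. *)
Lemma clique_hom_adj K (f g : morphism G H) x y :
  f \in clique_set K -> g \in clique_set K -> adj x y -> adj (f x) (g y).
Proof.
move=> fK gK xy; have [<-|f_neq_g] := eqVneq f g.
  exact: implyP (forallP (forallP (mor_funP f) x) y) xy.
have /andP[_ /forall_inP/(_ f fK)/forall_inP/(_ g gK)] := clique_setP K.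
by rewrite f_neq_g /= => /forallP/(_ x)/forallP/(_ y)/implyP; apply.
Qed.

Definition span_fun K : {ffun G -> {set H}} :=
  [ffun x => [set (f : morphism G H) x | f in clique_set K]].

Lemma span_funP K : is_indexing (span_fun K).
Proof.
apply/andP; split.
  apply/forallP => x; have /andP[/set0Pn[f fK] _] := clique_setP K.
  by apply/set0Pn; exists ((f : morphism G H) x); rewrite ffunE; apply: imset_f.
apply/forallP => x; apply/forallP => y; apply/implyP => xy.
rewrite !ffunE; apply/forall_inP => _ /imsetP[f fK ->].
apply/forall_inP => _ /imsetP[g gK ->].
exact: clique_hom_adj fK gK xy.
Qed.

Definition span K : indexing G H := Indexing (span_funP K).

Lemma span_Psi_adj K eta : (span K <= eta)%O = (K <= Psi eta)%O.
Proof.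
apply/forallP/subsetP => [le_eta f fK | le_Psi x].
  rewrite inE; apply/forallP => x; apply: (subsetP (le_eta x)).
  by rewrite ffunE; apply: imset_f.
apply/subsetP => _ /[!ffunE] /imsetP[f /le_Psi + ->].
by rewrite inE => /forallP.
Qed.

(** The values of an associated map at different vertices are independent, so
    one of them can be prescribed. *)
Lemma associated_through eta x u :
  u \in eta x -> exists2 f : morphism G H, associated eta f & f x = u.
Proof.
move=> ux; have /andP[/set0Pn[f0 /[!inE] /forallP f0P] _] := Psi_clique eta.
have fP : associated eta [ffun z => if z == x then u else f0 z].
  by apply/forallP => z; rewrite ffunE; case: eqP => [->|].
by exists (Morphism (associated_morphism fP)) => //=; rewrite ffunE eqxx.
Qed.

Lemma PsiK : cancel (@Psi G H) span.
Proof.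
move=> eta; apply/le_anti; rewrite span_Psi_adj lexx /=.
apply/forallP => x; apply/subsetP => u /associated_through[f fP <-].
by rewrite ffunE; apply/imsetP; exists f; rewrite ?inE.
Qed.

Lemma Psi_mono : {mono @Psi G H : eta eta' / (eta <= eta')%O}.
Proof. by move=> eta eta'; rewrite -span_Psi_adj PsiK. Qed.

End Span.

Theorem proposition6p1 (G H : graph) :
  [/\ injective (@Psi G H),
      {mono @Psi G H : eta eta' / (eta <= eta')%O}
    & dismantles [set: clique (hom_graph G H)]
                 [set Psi eta | eta in [set: indexing G H]]].
Proof.
split; first exact: can_inj (@PsiK G H).
- exact: Psi_mono.
- exact: dismantles_adjoint (@span_Psi_adj G H).
Qed.
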